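(* Suppose that $g\in G(N)$ is a galaxy with $\ell\ge 2$ components such that: (i) each component has a total number of nodes between $3$ and $\min\{k-1,n/2\}$; (ii) no subset of components has a union of size exactly $k$. Then the sender's value satisfies $\operatorname{Val}_k(g)<V_k^n$, and there exists an extension $g^+$ of $g$ in which the sender can achieve $V_k^n$, i.e. there is $\pi\in\Pi$ with $V_k^{\pi}(g^+)=V_k^n$.
   Context: **Persuasion model.** $N=\{1,\dots,n\}$ is the set of receivers, $\Omega=\{X,Y\}$ the set of states, $\lambda^0$ a common prior on $\Omega$ with $\lambda^0(X),\lambda^0(Y)>0$. The critical mass $k$ is an integer with $\lfloor\frac{n+1}{2}\rfloor\le k\le n$, and $\lambda^0(X)<\frac{k}{n+k}$. All receivers have the same countably infinite message set $S_i$ (containing $x,y$); $S=\prod_{i\in N}S_i$ is the set of signals. An experiment is a map $\pi:\Omega\to\Delta(S)$, where $\Delta(S)$ is the set of finitely supported probability distributions on $S$; $\Pi$ is the set of all experiments; $S^\pi=\{s\in S:\exists\omega\in\Omega,\ \pi(s|\omega)>0\}$. A network $g$ on $N$ is an undirected graph, $g_{ij}=g_{ji}\in\{0,1\}$; $G(N)$ is the set of all networks on $N$; $g_0$ is the empty network. The neighborhood is $N_i(g)=\{j: g_{ij}=1\}\cup\{i\}$. A component is a connected component. A network $g^+\in G(N)$ is an extension of $g$ (written $g\subsetneq g^+$) if it is obtained from $g$ by adding one or more links (same set of receivers). Receiver $i$ observes $s_i(g)=(s_j)_{j\in N_i(g)}$. For $s\in S^\pi$ let $A_i^\pi(g,s)=\{t\in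 S^\pi: t_i(g)=s_i(g)\}$ and let the posterior be $$\lambda_i^{s,g}(\omega)=\frac{\sum_{t\in A_i^\pi(g,s)}\pi(t|\omega)\lambda^0(\omega)}{\sum_{\omega'\in\Omega}\sum_{t\in A_i^\pi(g,s)}\pi(t|\omega')\lambda^0(\omega')}.$$ Receiver $i$ takes action $x$ if $\lambda_i^{s,g}(X)\ge\frac12$ and action $y$ otherwise. The outcome is $x$ if at least $k$ receivers take action $x$, and $y$ otherwise. The value $V_k^\pi(g)$ of $\pi$ on $g$ is the (unconditional, under $\lambda^0$ and $\pi$) probability that the outcome is $x$. The value of the network is $\operatorname{Val}_k(g)=\sup_{\pi\in\Pi}V_k^\pi(g)$. $V_k^n:=\operatorname{Val}_k(g_0)$ is the value of the empty network on $n$ receivers; under the assumption $\lambda^0(X)<\frac{k}{n+k}$ it is known that $V_k^n=\frac{n+k}{k}\lambda^0(X)<1$. **Galaxy.** A galaxy is a network consisting of (disjoint) components, each having a central node that is connected to all other nodes of that component (arbitrary links among the other, peripheral, nodes of the same component are allowed). *)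

(* Defs.v *)
From HB Require Import structures.
From mathcomp Require Import all_boot all_order all_algebra finmap.
From mathcomp Require Import boolp classical_sets cardinality reals.

Set Implicit Arguments.
Unset Strict Implicit.
Unset Printing Implicit Defensive.

Import Order.TTheory GRing.Theory Num.Theory.
Local Open Scope ring_scope.

Inductive state : Set := stX | stY.

Definition bool_of_state (w : state) : bool := if w is stX then true else false.
Definition state_of_bool (b : bool) : state := if b then stX else stY.
Lemma bool_of_stateK : cancel bool_of_state state_of_bool.
Proof. by case. Qed.

HB.instance Definition _ := Finite.copy state (can_type bool_of_stateK).

Record network (n : nat) := Network {
  link :> rel 'I_n;
  link_sym : symmetric link;
  link_irrefl : irreflexive link }.

Section Networks.
Variable n : nat.
Implicit Types (g h : network n) (C : {set 'I_n}).

Lemma empty_link_sym : symmetric (fun _ _ : 'I_n => false).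
Proof. by []. Qed.
Lemma empty_link_irrefl : irreflexive (fun _ _ : 'I_n => false).
Proof. by []. Qed.
Definition empty_network : network n :=
  Network empty_link_sym empty_link_irrefl.

Definition neighborhood g (i : 'I_n) : {set 'I_n} := [set j | g i j] :|: [set i].

(* Proper: at least one link is added, none is removed. *)
Definition extension g h : Prop :=
  (forall i j, g i j -> h i j) /\ (exists i j, ~~ g i j /\ h i j).

Definition components g : {set {set 'I_n}} :=
  [set [set j | connect g i j] | i : 'I_n].

Definition galaxy g : Prop :=
  forall C, C \in components g ->
    exists2 c, c \in C & forall j, j \in C -> j != c -> g c j.

End Networks.

Definition signal (n : nat) (M : countType) := {ffun 'I_n -> M}.

Record fin_dist (R : realType) (T : choiceType) := FinDist {
  pmf :> {fsfun T -> R with 0};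
  pmf_ge0 : forall t, 0 <= pmf t;
  pmf_sum1 : \sum_(t <- finsupp pmf) pmf t = 1 }.

Definition experiment (R : realType) (n : nat) (M : countType) :=
  state -> fin_dist R (signal n M).

Section Persuasion.
Variables (R : realType) (n : nat) (M : countType) (prior : state -> R).
Implicit Types (g : network n) (p : experiment R n M) (s : signal n M).

Definition experiment_supp p : {fset signal n M} :=
  (finsupp (p stX) `|` finsupp (p stY))%fset.

Definition observed g s (i : 'I_n) : {ffun {j | j \in neighborhood g i} -> M} :=
  [ffun j => s (val j)].

Definition info_set g p s (i : 'I_n) : {fset signal n M} :=
  [fset t in experiment_supp p | observed g t i == observed g s i]%fset.

(* Only meaningful for s in [experiment_supp p], where the denominator is
   positive as soon as the prior is. *)
Definition posterior g p s (i : 'I_n) (w : state) : R :=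
  (\sum_(t <- info_set g p s i) p w t * prior w) /
  (\sum_(w' : state) \sum_(t <- info_set g p s i) p w' t * prior w').

Definition takes_x g p s (i : 'I_n) : bool := 2^-1 <= posterior g p s i stX.

Definition outcome_x (k : nat) g p s : bool :=
  (k <= #|[set i | takes_x g p s i]|)%N.

Definition experiment_value (k : nat) g p : R :=
  \sum_(w : state)
    prior w * \sum_(s <- finsupp (p w) | outcome_x k g p s) p w s.

(* The set is nonempty when M is inhabited, and bounded by 1 when the prior is
   a probability distribution, so that [sup] is a genuine supremum. *)
Definition network_value (k : nat) g : R :=
  sup (range (experiment_value k g)).

End Persuasion.

Definition empty_network_value (R : realType) (n : nat) (M : countType)
    (prior : state -> R) (k : nat) : R :=
  network_value M prior k (empty_network n).

(* Main.v *)
Require Import Defs.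
From HB Require Import structures.
From mathcomp Require Import all_boot all_order all_algebra finmap.
From mathcomp Require Import boolp classical_sets cardinality reals.
From mathcomp Require Import zify ring lra.
Import Order.TTheory GRing.Theory Num.Theory.
Local Open Scope ring_scope.

(** Write L for the prior probability of X, Z for the event that the outcome
is x, and B_i for the event that receiver i takes x.  Since
P(B_i, Y) <= P(B_i, X) <= L, summing over i gives k P(Z, Y) <= n L, so no
network has a value above (1 + n/k) L.

In a galaxy, the centre c of i's component observes everything i does, so the
events B_c \ B_i are made of information sets of c; this yields
P(B_i xor B_c, Y) <= gam_i + gam_c with gam_i = L - P(B_i, Y).  As no union of
components has size k, every signal with outcome x has more than k receivers
taking x, or a receiver disagreeing with its centre.  Hence k + 1 can replace k
at a cost proportional to the total slack, and the value is at most
(1 + n (n + 1) / ((n + 1) k + 1)) L in every galaxy as in the theorem.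

Conversely, if no closed neighbourhood contains another one, the bound
(1 + n/k) L is attained: recommend x to everybody in state X and to a random
set of k receivers (or to nobody) in state Y, and split each receiver's
recommendation by exclusive or into random shares held by its neighbours, so
that a receiver learns its own recommendation and nothing else.  The empty
network has this property.  For the extension, order the receivers so that the
components are intervals, and link the receivers at distance h = n/2 (rounded
down): components have size at most h, so the new links join distinct
components, reach every receiver, and join a receiver to at most one member of
any given component. *)

Set Implicit Arguments.
Unset Strict Implicit.
Unset Printing Implicit Defensive.

(** * Masses of events, weighed by how many receivers take x *)

Lemma ler_sum_saturated (R : numDomainType) (T : finType) (K : eqType)
    (f : T -> K) (B : pred T) (a b : T -> R) :
  (forall s t, f s = f t -> B s = B t) ->
  (forall s, B s -> \sum_(t | f t == f s) b t <= \sum_(t | f t == f s) a t) ->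
  \sum_(s | B s) b s <= \sum_(s | B s) a s.
Proof.
move=> Bf leba; pose c s := [set t | f t == f s].
(* [c s] is the fibre of [f] through [s]; [B] is a union of such fibres, and the inequality adds up
   over them. *)
rewrite (partition_big c predT) // [leRHS](partition_big c predT) //=.
apply: ler_sum => C _.
case: (pickP (fun s => B s && (c s == C))) => [s0 /andP[Bs0 /eqP <-]|C0].
  have eqc t : B t && (c t == c s0) = (f t == f s0).
    apply/andP/eqP => [[_ /eqP/setP/(_ t)]|e].
      by rewrite !inE eqxx => /esym/eqP.
    split; first by rewrite (Bf _ _ e).
    by apply/eqP/setP => u; rewrite !inE e.
  by rewrite !(eq_bigl _ _ eqc) leba.
by rewrite !big_pred0.
Qed.

Lemma sum_card_mem (R : pzSemiRingType) (T I : finType) (B : I -> pred T)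
    (b : T -> R) :
  \sum_s #|[set i | B i s]|%:R * b s = \sum_i \sum_(s | B i s) b s.
Proof.
under [RHS]eq_bigr do rewrite big_mkcond.
rewrite exchange_big; apply: eq_bigr => s _ /=.
rewrite -big_mkcond /= mulr_natl -sumr_const.
by apply: eq_bigl => i; rewrite inE.
Qed.

Section Accounting.
Variables (R : realDomainType) (T I : finType) (k : nat).
Variables (a b : T -> R) (B : I -> pred T).
Hypotheses (a_ge0 : forall s, 0 <= a s) (b_ge0 : forall s, 0 <= b s).
Hypothesis Bab : forall i, \sum_(s | B i s) b s <= \sum_(s | B i s) a s.

Let L := \sum_s a s.
Let Z s := (k <= #|[set i | B i s]|)%N.

Lemma sum_pred_le (c : T -> R) (P : pred T) : (forall s, 0 <= c s) ->
  \sum_(s | P s) c s <= \sum_s c s.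
Proof.
by move=> c0; rewrite big_mkcond; apply: ler_sum => s _; case: ifP.
Qed.

(** Markov's inequality for the number of events [B i] that occur. *)
Lemma quota_mass_sum : k%:R * \sum_(s | Z s) b s <= \sum_i \sum_(s | B i s) b s.
Proof.
rewrite -sum_card_mem mulr_sumr big_mkcond /=; apply: ler_sum => s _.
case: ifP => [Zs|_]; first by rewrite ler_wpM2r // ler_nat.
by rewrite mulr_ge0 // ler0n.
Qed.

Lemma quota_mass_le : k%:R * \sum_(s | Z s) b s <= #|I|%:R * L.
Proof.
apply: le_trans quota_mass_sum _.
rewrite -[#|I|]/(#|xpredT|) mulr_natl -sumr_const; apply: ler_sum => i _.
exact: le_trans (Bab i) (sum_pred_le _ a_ge0).
Qed.

(* [c i] is a receiver at least as well informed as [i]. *)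
Variable c : I -> I.
Hypothesis Bcab : forall i,
  \sum_(s | B (c i) s && ~~ B i s) b s <= \sum_(s | B (c i) s && ~~ B i s) a s.
Hypothesis split_at_quota :
  forall s, #|[set i | B i s]| = k -> exists i, B i s != B (c i) s.

(** Let z be the [b]-mass of [Z]. Two bounds hold: k z <= |I| L - Gam, and (k + 1) z <= |I| L + |I|
    Gam. Adding |I| times the first to the second eliminates the total slack [Gam]. *)
Lemma quota_mass_lt :
  (#|I|.+1 * k + 1)%:R * \sum_(s | Z s) b s <= (#|I| * #|I|.+1)%:R * L.
Proof.
pose D i := \sum_(s | B i s != B (c i) s) b s.
pose gam i := L - \sum_(s | B i s) b s.
pose Gam := \sum_i gam i.
have gam_ge0 i : 0 <= gam i.
  by rewrite subr_ge0; exact: le_trans (Bab i) (sum_pred_le _ a_ge0).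
have D_le i : D i <= gam i + gam (c i).
  pose E := \sum_(s | B i s && B (c i) s) b s.
  pose F := \sum_(s | B i s && ~~ B (c i) s) b s.
  pose G := \sum_(s | B (c i) s && ~~ B i s) b s.
  have bi : \sum_(s | B i s) b s = E + F by rewrite (bigID (B (c i))).
  have bc : \sum_(s | B (c i) s) b s = E + G.
    rewrite (bigID (B i)); congr (_ + _); apply: eq_bigl => s.
    by rewrite andbC.
  have -> : D i = F + G.
    rewrite /D (bigID (B i)); congr (_ + _); apply: eq_bigl => s;
    by case: (B i s); case: (B (c i) s).
  (* The events behind [G] and [B i] are disjoint. This gives [G <= gam i]; since [E + F + G <= L]
     as well, it also gives [F <= gam (c i)]. *)
  have : G + \sum_(s | B i s) b s <= L.
    apply: (@le_trans _ _ (\sum_(s | B (c i) s && ~~ B i s) a s + \sum_(s | B i s) a s)).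
      by rewrite lerD // Bcab.
    rewrite [L in _ <= L](bigID (B i)) /= [leRHS]addrC lerD //.
    by rewrite big_mkcond [leRHS]big_mkcond; apply: ler_sum => s _;
      case: (B i s); case: (B (c i) s) => //=.
  rewrite /gam bi bc; lra.
have gam_le_Gam i : gam i <= Gam.
  by rewrite /Gam (bigD1 i) //= lerDl sumr_ge0.
have sum_b : \sum_i \sum_(s | B i s) b s = #|I|%:R * L - Gam.
  rewrite /Gam sumrB sumr_const -mulr_natl; lra.
have kZ : k%:R * \sum_(s | Z s) b s <= #|I|%:R * L - Gam.
  by rewrite -sum_b quota_mass_sum.
(* On [Z] the count plus the number of disagreements is at least k + 1, because a count of exactly
   [k] forces a disagreement. *)
have k1Z : k.+1%:R * \sum_(s | Z s) b s <= #|I|%:R * L + #|I|%:R * Gam.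
  apply: (@le_trans _ _ (\sum_i \sum_(s | B i s) b s + \sum_i D i)).
    rewrite -sum_card_mem -sum_card_mem -big_split mulr_sumr big_mkcond /=.
    apply: ler_sum => s _; rewrite -mulrDl -natrD.
    case: ifP => [Zs|_]; last by rewrite mulr_ge0 // ler0n.
    rewrite ler_wpM2r // ler_nat.
    move: Zs; rewrite /Z leq_eqVlt => /orP[/eqP kE|]; last first.
      by move/leq_trans; apply; rewrite leq_addr.
    have [i ni] := split_at_quota (esym kE).
    rewrite -kE -addn1 leq_add2l card_gt0; apply/finset.set0Pn.
    by exists i; rewrite inE.
  (* [c] need not be injective, so each [gam (c i)] is bounded by all of [Gam]. *)
  have: \sum_i D i <= Gam + #|I|%:R * Gam.
    apply: le_trans (ler_sum _ (fun i _ => D_le i)) _.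
    rewrite big_split lerD2l /= -[#|I|]/(#|xpredT|) mulr_natl -sumr_const.
    by apply: ler_sum.
  rewrite sum_b; lra.
have nkZ : #|I|%:R * (k%:R * \sum_(s | Z s) b s) <= #|I|%:R * (#|I|%:R * L - Gam).
  by rewrite ler_wpM2l // ler0n.
have -> : (#|I|.+1 * k + 1)%N = (#|I| * k + k.+1)%N by lia.
rewrite natrD natrM mulrDl -mulrA mulnS natrD natrM.
lra.
Qed.

End Accounting.

(** * Finite experiments encoded with messages from [M] *)

Lemma exists_embedding (T : finType) (M : choiceType) (m0 : M) :
  infinite_set [set: M]%classic -> exists e : T -> M, injective e.
Proof.
move=> /(@infinite_set_fset M _ #|T|)[B _ leB].
exists (fun t => nth m0 B (enum_rank t)) => t u /eqP.
rewrite nth_uniq ?fset_uniq //; last 2 first.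
- exact: leq_trans (ltn_ord _) leB.
- exact: leq_trans (ltn_ord _) leB.
by move=> /eqP/val_inj/enum_rank_inj.
Qed.

(** Push-forward of [P] along [e]. The first clause serves to compute values and information set
    masses, the second to decide which signals lie in the support. *)
Lemma exists_fin_dist (R : realType) (T : finType) (S : choiceType)
    (e : T -> S) (P : T -> R) :
  injective e -> (forall t, 0 <= P t) -> \sum_t P t = 1 ->
  exists d : fin_dist R S,
    (forall Q : pred S, \sum_(s <- finsupp d | Q s) d s = \sum_(t | Q (e t)) P t)
    /\ (forall t, d (e t) = P t).
Proof.
move=> e_inj P_ge0 P1.
pose A : {fset S} := [fset e t | t in T]%fset.
pose d : {fsfun S -> R with 0} :=
  [fsfun s in A => \sum_(t | e t == s) P t | 0].
have dE t : d (e t) = P t.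
  rewrite fsfunE in_imfset //= (bigD1 t) //= big1 ?addr0 // => u.
  by move=> /andP[/eqP/e_inj ->]; rewrite eqxx.
have dA : (finsupp d `<=` A)%fset by apply: finsupp_sub.
have dQ (Q : pred S) :
    \sum_(s <- finsupp d | Q s) d s = \sum_(t | Q (e t)) P t.
  rewrite big_mkcond (big_fset_incl _ dA) => [|s _]; last first.
    by move=> /fsfun_dflt ->; case: ifP.
  rewrite big_imfset /=; last by move=> ? ? _ _; apply: e_inj.
  rewrite big_enum /= [RHS]big_mkcond; apply: eq_bigr => t _.
  by rewrite dE.
have d_ge0 s : 0 <= d s.
  by rewrite fsfunE; case: ifP => // _; apply: sumr_ge0.
have d1 : \sum_(t <- finsupp d) d t = 1 by rewrite (dQ predT).
by exists (FinDist d_ge0 d1).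
Qed.

Lemma sum_state (R : nmodType) (F : state -> R) :
  \sum_(w : state) F w = F stX + F stY.
Proof.
rewrite (bigD1 stX) //= (bigD1 stY) //= big1 ?addr0 // => w.
by case: w.
Qed.

(** * Obedience in terms of joint probabilities *)

Section Experiments.
Variables (R : realType) (n : nat) (M : countType) (prior : state -> R).
Hypotheses (prior_gt0 : forall w, 0 < prior w).
Implicit Types (g : network n) (p : experiment R n M) (s : signal n M).

Lemma finsupp_sub_experiment_supp p w :
  (finsupp (p w) `<=` experiment_supp p)%fset.
Proof. by case: w; rewrite ?fsubsetUl ?fsubsetUr. Qed.

Lemma sum_experiment_supp p w (Q : pred (signal n M)) :
  \sum_(s <- finsupp (p w) | Q s) p w s =
  \sum_(s <- experiment_supp p | Q s) p w s.
Proof.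
rewrite big_mkcond [RHS]big_mkcond.
apply: (big_fset_incl _ (finsupp_sub_experiment_supp p w)) => s _.
by move=> /fsfun_dflt ->; case: ifP.
Qed.

Lemma sum_finsupp p w (Q : pred (signal n M)) :
  \sum_(s <- finsupp (p w) | Q s) p w s =
  \sum_(s : experiment_supp p | Q (val s)) p w (val s).
Proof. by rewrite sum_experiment_supp big_seq_fsetE. Qed.

Lemma sum_pmf p w : \sum_(s : experiment_supp p) p w (val s) = 1.
Proof. by rewrite -(pmf_sum1 (p w)) (sum_finsupp p w predT). Qed.

(** Clear the denominator, positive on the support. An empty information set would have posterior
    0/0 = 0, hence action y, although the inequality would read 0 <= 0. *)
Lemma takes_xE g p s i : s \in experiment_supp p ->
  takes_x prior g p s i =
  (prior stY * \sum_(t <- finsupp (p stY) | observed g t i == observed g s i)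
     p stY t <=
   prior stX * \sum_(t <- finsupp (p stX) | observed g t i == observed g s i)
     p stX t).
Proof.
move=> sS; rewrite /takes_x /posterior sum_state.
have massE w : \sum_(t <- info_set g p s i) p w t * prior w =
    prior w * \sum_(t <- finsupp (p w) | observed g t i == observed g s i) p w t.
  by rewrite -mulr_suml mulrC sum_experiment_supp big_fset.
have mass_ge0 w :
    0 <= prior w * \sum_(t <- finsupp (p w) | observed g t i == observed g s i) p w t.
  by apply: mulr_ge0; [exact: ltW | apply: sumr_ge0 => t _; exact: pmf_ge0].
have mass_gt0 w : s \in finsupp (p w) ->
    0 < prior w * \sum_(t <- finsupp (p w) | observed g t i == observed g s i) p w t.
  move=> sw; rewrite mulr_gt0 // big_fset_condE (big_fsetD1 s) /=; last first.
    by rewrite !inE sw eqxx.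
  rewrite ltr_pwDl ?sumr_ge0 // => [|t _]; last exact: pmf_ge0.
  by rewrite lt_neqAle eq_sym -mem_finsupp sw pmf_ge0.
rewrite !massE.
set A := prior stX * _ in mass_ge0 mass_gt0 *.
set B := prior stY * _ in mass_ge0 mass_gt0 *.
have AB_gt0 : 0 < A + B.
  move: sS; rewrite inE => /orP[/mass_gt0 h|/mass_gt0 h].
    exact: ltr_wpDr (mass_ge0 stY) h.
  exact: ltr_wpDl (mass_ge0 stX) h.
rewrite ler_pdivlMr //; apply/idP/idP; lra.
Qed.

Lemma takes_x_observed g p s t i :
  observed g s i = observed g t i -> takes_x prior g p s i = takes_x prior g p t i.
Proof. by move=> e; rewrite /takes_x /posterior /info_set e. Qed.

Lemma observed_sub g i j s t : neighborhood g i \subset neighborhood g j ->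
  observed g s j = observed g t j -> observed g s i = observed g t i.
Proof.
move=> /fintype.subsetP sij /ffunP e; apply/ffunP => -[m mi].
by have := e (Sub m (sij m mi)); rewrite !ffunE.
Qed.

End Experiments.

(** * Upper bounds on the value of an experiment *)

Section UpperBounds.
Variables (R : realType) (n k : nat) (M : countType) (prior : state -> R).
Hypotheses (prior_gt0 : forall w, 0 < prior w).
Variables (g : network n) (p : experiment R n M).

Let T : finType := experiment_supp p.
Let mass w (s : T) := prior w * p w (val s).
Let takes i (s : T) := takes_x prior g p (val s) i.

Lemma mass_ge0 w s : 0 <= mass w s.
Proof. by apply: mulr_ge0; [exact: ltW | exact: pmf_ge0]. Qed.

Lemma sum_mass w : \sum_s mass w s = prior w.
Proof. by rewrite -mulr_sumr sum_pmf mulr1. Qed.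

Lemma experiment_value_sum :
  experiment_value prior k g p =
  \sum_(s | (k <= #|[set i | takes i s]|)%N) mass stX s +
  \sum_(s | (k <= #|[set i | takes i s]|)%N) mass stY s.
Proof. by rewrite /experiment_value sum_state !sum_finsupp !mulr_sumr. Qed.

(** [B] is a union of information sets of [i], each with at least as much mass in state X as in Y. A
    general [B] is allowed so that the events where a centre takes x and a peripheral receiver does
    not are covered. *)
Lemma obedient_mass i (B : pred T) :
  (forall s t : T, observed g (val s) i = observed g (val t) i -> B s = B t) ->
  (forall s, B s -> takes i s) ->
  \sum_(s | B s) mass stY s <= \sum_(s | B s) mass stX s.
Proof.
move=> Bobs Btakes; apply: ler_sum_saturated Bobs _ => s /Btakes.
by rewrite /takes takes_xE ?fsvalP // !sum_finsupp !mulr_sumr.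
Qed.

Lemma obedient_takes i :
  \sum_(s | takes i s) mass stY s <= \sum_(s | takes i s) mass stX s.
Proof. by apply: (@obedient_mass i) => // s t; exact: takes_x_observed. Qed.

Lemma experiment_value_le : (0 < k)%N ->
  experiment_value prior k g p <= (1 + n%:R / k%:R) * prior stX.
Proof.
move=> k_gt0; rewrite experiment_value_sum mulrDl mul1r lerD //.
  rewrite -[leRHS]sum_mass; apply: sum_pred_le; exact: mass_ge0.
rewrite mulrAC ler_pdivlMr ?ltr0n // mulrC.
have := quota_mass_le k (mass_ge0 stX) (mass_ge0 stY) obedient_takes.
by rewrite card_ord sum_mass.
Qed.

Lemma experiment_value_centred_le (c : 'I_n -> 'I_n) :
  (forall i, neighborhood g i \subset neighborhood g (c i)) ->
  (forall A : {set 'I_n}, #|A| = k -> exists i, (i \in A) != (c i \in A)) ->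
  experiment_value prior k g p <=
    (1 + (n * n.+1)%:R / (n.+1 * k + 1)%:R) * prior stX.
Proof.
move=> sub_c split_c; rewrite experiment_value_sum mulrDl mul1r lerD //.
  rewrite -[leRHS]sum_mass; apply: sum_pred_le; exact: mass_ge0.
rewrite mulrAC ler_pdivlMr ?ltr0n ?addn1 // mulrC.
have := quota_mass_lt (mass_ge0 stX) (mass_ge0 stY) obedient_takes (k := k) (c := c).
rewrite card_ord sum_mass addn1; apply.
(* The centre's observation determines the action of [i] too, so the difference event is a union of
   information sets of [c i]. *)
- move=> i; apply: (@obedient_mass (c i)) => [s t e|s /andP[] //].
  congr (_ && ~~ _); first exact: takes_x_observed e.
  exact: takes_x_observed (observed_sub (sub_c i) e).
- by move=> s /split_c[i]; rewrite !inE; exists i.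
Qed.

End UpperBounds.

(** * Sharing recommendations secretly among neighbours *)

Section SecretSharing.
Variables (I : finType) (N : I -> {set I}).
Implicit Types (sigma tau : {ffun I -> {set I}}) (A T U : {set I}).

(* Receiver [j] holds one share of every [i]'s recommendation, namely
   [i \in sigma j]; the recommendation is the exclusive or of the shares held
   in the neighbourhood of [i]. *)
Definition recommended sigma : {set I} :=
  [set i | \big[addb/false]_(j in N i) (i \in sigma j)].

Lemma recommended_local sigma tau i :
  (forall j, j \in N i -> sigma j = tau j) ->
  (i \in recommended sigma) = (i \in recommended tau).
Proof. by move=> e; rewrite !inE; apply: eq_bigr => j /e ->. Qed.

(** Toggles the recommendation of every [m] in [U] by changing one bit only, the share held by
    [j m]. *)
Definition flip_shares (U : {set I}) (j : I -> I) sigma : {ffun I -> {set I}} :=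
  [ffun l => [set m | (m \in sigma l) (+) ((m \in U) && (l == j m))]].

Lemma flip_sharesK U j : involutive (flip_shares U j).
Proof.
by move=> sigma; apply/ffunP => l; apply/setP => m; rewrite !(ffunE, inE) addbK.
Qed.

Lemma recommended_flip U j sigma m : (m \in U -> j m \in N m) ->
  (m \in recommended (flip_shares U j sigma)) =
  (m \in recommended sigma) (+) (m \in U).
Proof.
move=> jN; rewrite !inE.
under eq_bigr do rewrite ffunE inE.
rewrite big_split /=; congr (_ (+) _).
case: (boolP (m \in U)) => [/jN jm|_]; last by rewrite big1.
by rewrite (bigD1 (j m)) //= eqxx big1 ?addbF // => l /andP[_ /negbTE].
Qed.

Definition sharings A sigma0 T :=
  [set sigma | (recommended sigma == T) && [forall j in A, sigma j == sigma0 j]].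

(** Secrecy: where [T] and [U] differ, flipping a share held outside [A] turns one into the other
    unnoticed by [A]. The flip is an involution, hence injective. *)
Lemma card_sharings A sigma0 T U :
  (forall m, (m \in T) != (m \in U) -> exists2 j, j \in N m & j \notin A) ->
  #|sharings A sigma0 T| = #|sharings A sigma0 U|.
Proof.
wlog suff le_card : T U / (forall m, (m \in T) != (m \in U) ->
    exists2 j, j \in N m & j \notin A) ->
    (#|sharings A sigma0 T| <= #|sharings A sigma0 U|)%N.
  move=> avoid; apply/eqP; rewrite eqn_leq !le_card // => m.
  by rewrite eq_sym; exact: avoid.
move=> avoid; pose W := [set m | (m \in T) != (m \in U)].
have j_spec m : exists j, m \in W -> (j \in N m) && (j \notin A).
  case: (boolP (m \in W)) => [|_]; last by exists m.
  by rewrite inE => /avoid[j jN jA]; exists j; rewrite jN jA.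
have [j jP] := boolp.choice j_spec.
rewrite -(card_imset _ (inv_inj (flip_sharesK W j))).
apply/subset_leq_card/fintype.subsetP => _ /imsetP[sigma + ->].
rewrite !inE => /andP[/eqP recT /'forall_implyP agree].
apply/andP; split.
  apply/eqP/setP => m; rewrite recommended_flip => [|/jP/andP[] //].
  by rewrite recT inE; case: (m \in T); case: (m \in U).
apply/'forall_implyP => l lA; rewrite -(eqP (agree l lA)) ffunE.
apply/eqP/setP => m; rewrite inE.
case: (boolP (m \in W)) => [/jP/andP[_ jA]|_]; last by rewrite addbF.
by case: eqP => [e|_]; rewrite ?addbF //; move: jA; rewrite -e lA.
Qed.

Variables (R : realFieldType) (w : {set I} -> R).
Hypothesis self_mem : forall i, i \in N i.

Let nb_sharings := #|[set sigma | recommended sigma == finset.set0]|.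

(** Draw [T] from [w], then a sharing of [T] uniformly; by [card_recommended] one normalisation fits
    every [T]. *)
Definition sharing_weight sigma := w (recommended sigma) / nb_sharings%:R.

Lemma nb_sharings_gt0 : (0 < nb_sharings)%N.
Proof.
rewrite card_gt0; apply/finset.set0Pn; exists [ffun=> finset.set0].
rewrite inE; apply/eqP/setP => i; rewrite !inE big1 // => j _.
by rewrite ffunE inE.
Qed.

(** The secrecy count with an empty coalition: the share that each receiver holds for itself can
    always be flipped. *)
Lemma card_recommended T : #|[set sigma | recommended sigma == T]| = nb_sharings.
Proof.
have setE U : [set sigma | recommended sigma == U] =
    sharings finset.set0 [ffun=> finset.set0] U.
  apply/setP => sigma; rewrite !inE; case: eqP => //= _; apply/esym/forallP => j.
  by rewrite inE.
rewrite /nb_sharings !setE; apply: card_sharings => m _.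
by exists m; rewrite ?inE.
Qed.

Lemma sum_sharing_weight (Q : pred {set I}) :
  \sum_(sigma | Q (recommended sigma)) sharing_weight sigma = \sum_(T | Q T) w T.
Proof.
rewrite (partition_big recommended Q) //; apply: eq_bigr => T QT.
rewrite (eq_bigr (fun=> w T / nb_sharings%:R)); last first.
  by move=> sigma /andP[_ /eqP <-].
rewrite sumr_const; transitivity (w T / nb_sharings%:R *+ nb_sharings).
  congr (_ *+ _); rewrite -(card_recommended T); apply: eq_card => sigma.
  by rewrite !inE unfold_in; case: eqP => [->|]; rewrite ?QT ?andbF.
by rewrite -mulr_natr divfK // pnatr_eq0 -lt0n nb_sharings_gt0.
Qed.

(* If every other neighbourhood escapes [N i], then [i]'s observation reveals
   nothing beyond its own recommendation. *)
Lemma sum_sharing_weight_observed i sigma0 :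
  (forall m, m != i -> exists2 j, j \in N m & j \notin N i) ->
  i \in recommended sigma0 ->
  \sum_(sigma : {ffun I -> {set I}} | [forall j in N i, sigma j == sigma0 j])
     sharing_weight sigma =
  #|sharings (N i) sigma0 (recommended sigma0)|%:R / nb_sharings%:R *
    \sum_(T : {set I} | i \in T) w T.
Proof.
move=> escape i_rec.
rewrite (partition_big recommended (fun T : {set I} => i \in T)) => [|sigma]; last first.
  move/'forall_implyP => agree; rewrite -(recommended_local (sigma := sigma0)) //.
  by move=> j /agree/eqP.
rewrite mulr_sumr; apply: eq_bigr => T iT.
rewrite (eq_bigr (fun=> w T / nb_sharings%:R)); last first.
  by move=> sigma /andP[_ /eqP <-].
rewrite sumr_const -[LHS]mulr_natl mulrCA mulrC; congr (_%:R / _ * _).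
rewrite (@card_sharings _ _ _ T) => [|m].
  by apply: eq_card => sigma; rewrite !inE unfold_in andbC.
(* Both sets contain [i], so they can differ only at receivers to which [escape] applies. *)
case: (eqVneq m i) => [->|/escape //]; by rewrite i_rec iT.
Qed.

End SecretSharing.

(** * Attaining the bound when no closed neighbourhood contains another *)

Lemma sum_card_eq_weight (R : pzSemiRingType) (I : finType) (k : nat) (q : R)
    (P : pred {set I}) :
  \sum_(T : {set I} | P T) (if #|T| == k then q else 0) =
  q *+ #|[set T : {set I} | P T && (#|T| == k)]|.
Proof.
rewrite -big_mkcondr -sumr_const; apply: eq_bigl => T; by rewrite inE.
Qed.

(** By Pascal's rule, removing the draws that avoid [i] leaves C(|I| - 1, k - 1). Thus a uniform
    draw contains a given receiver with probability k/|I|. *)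
Lemma card_draws_mem (I : finType) (i : I) (k : nat) :
  (#|I| * #|[set T : {set I} | (i \in T) && (#|T| == k)]| = k * 'C(#|I|, k))%N.
Proof.
pose A := [set T : {set I} | (i \in T) && (#|T| == k)].
pose B := [set T : {set I} | (T \subset ~: [set i]) && (#|T| == k)].
have cB : #|B| = 'C(#|I|.-1, k) by rewrite cards_draws cardsC1.
have : (#|A| + #|B| = 'C(#|I|, k))%N.
  rewrite -card_draws -[RHS](cardsID [set T : {set I} | i \in T]); congr (_ + _)%N.
    by apply: eq_card => T; rewrite !inE andbC.
  by apply: eq_card => T; rewrite !inE finset.subsetC finset.sub1set inE andbC.
have I_gt0 : (0 < #|I|)%N by apply/card_gt0P; exists i.
rewrite cB -/A; case: k @A @B cB => [|k] A B _.
  by rewrite !bin0 => /eqP; rewrite -[X in _ == X]add0n eqn_add2r => /eqP ->; rewrite muln0.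
rewrite -mul_bin_diag -[in 'C(#|I|, _)](prednK I_gt0) binS addnC => /addnI ->.
by [].
Qed.

Section Attainment.
Variables (R : realType) (n k : nat) (M : countType) (m0 : M).
Hypothesis M_infinite : infinite_set [set: M]%classic.
Variable prior : state -> R.
Hypotheses (prior_gt0 : forall w, 0 < prior w).
Variable g : network n.
Hypothesis escape : forall i m, m != i ->
  exists2 j, j \in neighborhood g m & j \notin neighborhood g i.

(** Reduces the design to the law of the recommended set, the last hypothesis being obedience.
    Receivers without a recommendation may still take x, which can only raise the value; hence an
    inequality. *)
Lemma private_recommendations (w : state -> {set 'I_n} -> R) :
  (forall x T, 0 <= w x T) -> (forall x, \sum_T w x T = 1) ->
  (forall i, prior stY * \sum_(T : {set 'I_n} | i \in T) w stY T <=
             prior stX * \sum_(T : {set 'I_n} | i \in T) w stX T) ->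
  exists p : experiment R n M,
    \sum_(x : state) prior x * \sum_(T : {set 'I_n} | (k <= #|T|)%N) w x T
    <= experiment_value prior k g p.
Proof.
move=> w_ge0 w1 w_obedient; pose N := neighborhood g.
have self_mem i : i \in N i by rewrite !inE eqxx orbT.
have [e e_inj] := exists_embedding {set 'I_n} m0 M_infinite.
pose enc (sigma : {ffun 'I_n -> {set 'I_n}}) : signal n M := [ffun j => e (sigma j)].
have enc_inj : injective enc.
  by move=> s t /ffunP st; apply/ffunP => j; apply: e_inj; have := st j; rewrite !ffunE.
pose P x := sharing_weight N (w x).
have P_ge0 x sigma : 0 <= P x sigma by rewrite divr_ge0.
have P1 x : \sum_sigma P x sigma = 1.
  by rewrite (sum_sharing_weight (w x) self_mem predT) w1.
pose p x := projT1 (cid (exists_fin_dist enc_inj (P_ge0 x) (P1 x))).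
have pP x := projT2 (cid (exists_fin_dist enc_inj (P_ge0 x) (P1 x))).
have p_sum x Q : \sum_(s <- finsupp (p x) | Q s) p x s =
    \sum_(sigma | Q (enc sigma)) P x sigma by have [] := pP x.
have p_enc x sigma : p x (enc sigma) = P x sigma by have [] := pP x.
exists p; rewrite /experiment_value; apply: ler_sum => x _.
rewrite ler_wpM2l ?(ltW (prior_gt0 x)) // p_sum.
rewrite -(sum_sharing_weight (w x) self_mem (fun T => k <= #|T|)%N).
rewrite big_mkcond [leRHS]big_mkcond; apply: ler_sum => sigma _.
case: ifP => [k_le|_]; last by case: ifP => // _; exact: P_ge0.
case: ifP => // /negP no_x.
(* A sharing of weight zero contributes nothing; any other lies in the support, where [takes_xE]
   applies. *)
have [P0|Pn0] := eqVneq (P x sigma) 0; first by rewrite -/(P x sigma) P0.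
case: no_x; apply: leq_trans k_le _; apply/subset_leq_card/fintype.subsetP => i i_rec.
have supp : enc sigma \in experiment_supp p.
  apply: (fsubsetP (finsupp_sub_experiment_supp p x)).
  by rewrite mem_finsupp p_enc.
rewrite inE takes_xE // !p_sum.
have obsE tau : (observed g (enc tau) i == observed g (enc sigma) i) =
    [forall j in N i, tau j == sigma j].
  apply/eqP/'forall_implyP => [/ffunP o j jN|agree].
    by have := o (Sub j jN); rewrite !ffunE /= => /e_inj ->.
  by apply/ffunP => -[j jN]; rewrite !ffunE /= (eqP (agree j jN)).
(* The factor counting compatible sharings is the same in both states, so only [w_obedient]
   remains. *)
rewrite !(eq_bigl _ _ obsE) !sum_sharing_weight_observed //; try exact: escape.
by rewrite 2!(mulrCA (prior _)) ler_wpM2l // divr_ge0.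
Qed.

Lemma exists_optimal_experiment : (0 < k <= n)%N ->
  prior stX + prior stY = 1 -> prior stX < k%:R / (n + k)%:R ->
  exists p : experiment R n M,
    (1 + n%:R / k%:R) * prior stX <= experiment_value prior k g p.
Proof.
move=> /andP[k_gt0 k_le] prior1 prior_lt.
have k0 : 0 < k%:R :> R by rewrite ltr0n.
have n0 : 0 < n%:R :> R by rewrite ltr0n (leq_trans k_gt0).
have C0 : 0 < 'C(n, k)%:R :> R by rewrite ltr0n bin_gt0.
have Y0 := prior_gt0 stY; have X0 := prior_gt0 stX.
(* The probability of recommending x to a random k-set in state Y. It makes obedience bind, as
   prior(Y) q k/n = prior(X), and [q <= 1] amounts to prior(X) <= k/(n + k). *)
pose q := n%:R / k%:R * prior stX / prior stY.
have q_ge0 : 0 <= q by rewrite !(divr_ge0, mulr_ge0) // ltW.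
have q_le1 : q <= 1.
  rewrite ler_pdivrMr // mul1r mulrAC ler_pdivrMr //.
  move: prior_lt; rewrite ltr_pdivlMr ?ltr0n ?addn_gt0 ?k_gt0 ?orbT // natrD.
  have -> : prior stY = 1 - prior stX by rewrite -prior1 addrC addKr.
  lra.
pose wX (T : {set 'I_n}) : R := (T == [set: 'I_n])%:R.
pose wY (T : {set 'I_n}) : R := (if #|T| == k then q / 'C(n, k)%:R else 0)
  + (if T == finset.set0 then 1 - q else 0).
pose w x := if x is stX then wX else wY.
have wY_sum (Q : pred {set 'I_n}) : ~~ Q finset.set0 ->
    \sum_(T | Q T) wY T =
    q / 'C(n, k)%:R *+ #|[set T : {set 'I_n} | Q T && (#|T| == k)]|.
  move=> Q0; rewrite big_split sum_card_eq_weight /= [X in _ + X]big1 ?addr0 // => T QT.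
  by case: eqP QT Q0 => // -> ->.
have wX_sum (Q : pred {set 'I_n}) : Q [set: 'I_n] -> \sum_(T | Q T) wX T = 1.
  move=> QT; rewrite (bigD1 [set: 'I_n]) //= /wX eqxx big1 ?addr0 // => T.
  by case/andP => _ /negbTE ->.
have [||i|p pP] := @private_recommendations w; last first.
- exists p; apply: le_trans pP; rewrite sum_state /=.
  rewrite wX_sum ?cardsT ?card_ord // wY_sum ?cards0 -?ltnNge //.
  rewrite (_ : [set T : {set 'I_n} | _] = [set T : {set 'I_n} | #|T| == k]); last first.
    by apply/setP => T; rewrite !inE andbC; case: eqP => // ->; rewrite leqnn.
  rewrite card_draws card_ord -[_ / _ *+ _]mulr_natr divfK ?gt_eqF // mulr1 mulrDl mul1r.
  by rewrite lerD2l /q [leRHS]mulrC divfK ?gt_eqF.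
- rewrite /= wX_sum ?inE // wY_sum ?inE // mulr1.
  set c := #|_|.
  have /(congr1 (fun m => m%:R : R)) := card_draws_mem i k.
  rewrite card_ord !natrM -/c => nc.
  rewrite -[_ / _ *+ _]mulr_natr /q le_eqVlt; apply/orP; left; apply/eqP.
  rewrite mulrCA -!mulrA.
  have -> : c%:R = k%:R * 'C(n, k)%:R / n%:R :> R.
    by rewrite -nc mulrC mulKf // gt_eqF.
  by field; rewrite !gt_eqF.
- case; first by rewrite /= wX_sum.
  rewrite /= /wY big_split sum_card_eq_weight /= -big_mkcond big_pred1_eq.
  rewrite (_ : [set T : {set 'I_n} | _] = [set T : {set 'I_n} | #|T| == k]); last first.
    by apply/setP => T; rewrite !inE.
  by rewrite card_draws card_ord -[_ / _ *+ _]mulr_natr divfK ?gt_eqF // addrC subrK.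
- case=> T; rewrite /= /wX /wY ?ler0n // addr_ge0 //; case: ifP => // _.
    by rewrite divr_ge0 // ltW.
  by rewrite subr_ge0.
Qed.

End Attainment.

(** * Components of a galaxy and their linear arrangement *)

Section Components.
Variables (n : nat) (g : network n).

Definition component (i : 'I_n) : {set 'I_n} := [set j | connect g i j].

Lemma component_in i : component i \in components g.
Proof. exact: imset_f. Qed.

Lemma mem_component i : i \in component i.
Proof. by rewrite inE connect0. Qed.

Lemma network_connect_sym : connect_sym g.
Proof. exact/sym_connect_sym/link_sym. Qed.

Lemma component_eq i j : (component i == component j) = (j \in component i).
Proof.
apply/eqP/idP => [->|]; first exact: mem_component.
rewrite inE => ij; apply/setP => m; rewrite !inE.
exact: (same_connect network_connect_sym ij).
Qed.

Lemma link_component i j : g i j -> component i = component j.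
Proof. by move=> gij; apply/eqP; rewrite component_eq inE connect1. Qed.

Hypothesis g_galaxy : galaxy g.

Lemma galaxy_centre : exists c : 'I_n -> 'I_n,
  (forall i, neighborhood g i \subset neighborhood g (c i)) /\
  (forall i j, component i = component j -> c i = c j).
Proof.
(* The centre is chosen per component, not per receiver, so that it is constant on components;
   [None] stands for sets that are not components. *)
have centre (C : {set 'I_n}) : exists c : option 'I_n, C \in components g ->
    if c is Some c then c \in C /\ forall j, j \in C -> j != c -> g c j else False.
  case: (boolP (C \in components g)) => [/g_galaxy[c cC cg]|_]; last by exists None.
  by exists (Some c).
have [d dP] := boolp.choice centre.
pose c i := odflt i (d (component i)).
have cP i : c i \in component i /\ forall j, j \in component i -> j != c i -> g (c i) j.
  by rewrite /c; have := dP _ (component_in i); case: (d _).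
exists c; split=> [i|i j ij]; last first.
  by rewrite /c -ij; have := dP _ (component_in i); case: (d _).
apply/fintype.subsetP => j ji; rewrite !inE.
have [->|jc] := eqVneq j (c i); first by rewrite orbT.
have [_ -> //] := cP i.
move: ji; rewrite !inE => /orP[/connect1 //|/eqP ->]; exact: connect0.
Qed.

(** A set in which every receiver agrees with its centre is a union of components, so its size is
    not [k]. *)
Lemma quota_splits_component (k : nat) (c : 'I_n -> 'I_n) :
  (forall i j, component i = component j -> c i = c j) ->
  (forall D : {set {set 'I_n}}, D \subset components g -> #|finset.cover D| <> k) ->
  forall A : {set 'I_n}, #|A| = k -> exists i, (i \in A) != (c i \in A).
Proof.
move=> c_const no_union A cardA.
case: (pickP (fun i => (i \in A) != (c i \in A))) => [i ?|agree]; first by exists i.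
case: (no_union [set C in components g | C \subset A]).
  by apply/fintype.subsetP => C; rewrite inE => /andP[].
rewrite -cardA; congr #|pred_of_set _|; apply/setP => i; apply/bigcupP/idP.
  by case=> C; rewrite inE => /andP[_ /fintype.subsetP sCA] /sCA.
move=> iA; exists (component i); last exact: mem_component.
rewrite inE component_in; apply/fintype.subsetP => j.
rewrite -component_eq => /eqP/c_const cij.
by have /negbFE/eqP -> := agree j; rewrite -cij; have /negbFE/eqP <- := agree i.
Qed.

Hypothesis g_size : forall i, (1 < #|component i|)%N.

Lemma galaxy_has_link i : exists j, g i j.
Proof.
have [c cC cg] := g_galaxy (component_in i).
have [ic|ic] := eqVneq i c; last first.
  by exists c; rewrite link_sym; apply: cg => //; exact: mem_component.
have /card_gt1P[x [y [xC yC xy]]] := g_size i.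
have [xc|xc] := eqVneq x c; last by exists x; rewrite ic; apply: cg.
by exists y; rewrite ic; apply: cg => //; rewrite -xc eq_sym.
Qed.

(* A linear order of the receivers in which components are intervals. *)
Let key (i : 'I_n) := (enum_rank (component i) * n + i)%N.

Definition position (i : 'I_n) : nat := #|[set j | (key j < key i)%N]|.

Lemma key_component_le i j : (key i <= key j)%N ->
  (enum_rank (component i) <= enum_rank (component j))%N.
Proof.
move=> le_ij; have : (key i %/ n <= key j %/ n)%N by exact: leq_div2r.
have n_gt0 : (0 < n)%N by exact: leq_ltn_trans (ltn_ord i).
by rewrite !divnMDl // !divn_small ?ltn_ord // !addn0.
Qed.

Lemma position_lt i j : (position i < position j)%N = (key i < key j)%N.
Proof.
have mono a b : (key a <= key b)%N -> (position a <= position b)%N.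
  move=> ab; apply/subset_leq_card/fintype.subsetP => m; rewrite !inE.
  by move/leq_trans; apply.
apply/idP/idP => [|ij]; first by apply: contraTT; rewrite -!leqNgt; exact: mono.
apply/proper_card/properP; split.
  by apply/fintype.subsetP => m; rewrite !inE => /ltn_trans; apply.
by exists i; rewrite inE ?ltnn.
Qed.

Lemma position_inj : injective position.
Proof.
move=> i j eq_ij; apply: val_inj => /=.
have keq : key i = key j.
  by case: (ltngtP (key i) (key j)) => //; rewrite -position_lt eq_ij ltnn.
have := congr1 (modn^~ n) keq.
by rewrite !modnMDl !modn_small.
Qed.

Lemma position_ltn i : (position i < n)%N.
Proof.
rewrite -[X in (_ < X)%N]card_ord -cardsT; apply/proper_card/properP.
by split; [exact: finset.subsetT | exists i; rewrite ?inE ?ltnn].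
Qed.

Lemma position_surj m : (m < n)%N -> exists i, position i = m.
Proof.
move=> mn; pose f i := Ordinal (position_ltn i).
have f_inj : injective f by move=> i j /(congr1 val)/position_inj.
by exists (invF f_inj (Ordinal mn)); have /(congr1 val) := f_invF f_inj (Ordinal mn).
Qed.

(** Any receiver ordered before [j] but not before [i] lies between two members of an interval,
    hence in the component without [j]. *)
Lemma position_component i j : component i = component j ->
  (position j < position i + #|component i|)%N.
Proof.
move=> cij; have [ij|ij] := ltnP (key i) (key j); last first.
  rewrite (leq_ltn_trans (n := position i)) //.
    by rewrite leqNgt position_lt -leqNgt.
  by rewrite -[X in (X < _)%N]addn0 ltn_add2l card_gt0; apply/finset.set0Pn;
    exists i; exact: mem_component.
rewrite (leq_ltn_trans (n := (position i + #|component i :\ j|)%N)) //; last first.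
  by rewrite ltn_add2l [X in (_ < X)%N](cardsD1 j) -component_eq cij eqxx add1n.
rewrite /position; set A := [set m | _]; set B := [set m | (key m < key i)%N].
have /subset_leq_card : A \subset B :|: (component i :\ j).
  apply/fintype.subsetP => m; rewrite !finset.in_setU !finset.in_setD1 inE inE => mj.
  have [//|im] := ltnP (key m) (key i); apply/andP; split.
    by apply: contraTneq mj => ->; rewrite ltnn.
  rewrite -component_eq; apply/eqP/enum_rank_inj/val_inj/eqP.
  by rewrite eqn_leq key_component_le //= cij key_component_le // ltnW.
by move/leq_trans; apply; rewrite leq_card_setU.
Qed.

End Components.

(** * The extension that bridges distinct components *)

Section Bridging.
Variables (n : nat) (g : network n).
Hypothesis g_galaxy : galaxy g.
Hypothesis g_size : forall i, (1 < #|component g i| <= n %/ 2)%N.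

Let pos := position g.
Let h := (n %/ 2)%N.

Definition bridge : rel 'I_n :=
  fun i j => (pos i + h == pos j)%N || (pos j + h == pos i)%N.

Lemma bridge_sym : symmetric bridge.
Proof. by move=> i j; rewrite /bridge orbC. Qed.

Lemma bridge_component i j : bridge i j -> component g i != component g j.
Proof.
apply: contraTneq => cij.
have ij := position_component cij; have ji := position_component (esym cij).
have /andP[_ hi] := g_size i; have /andP[_ hj] := g_size j.
by rewrite /bridge negb_or /pos /h; lia.
Qed.

Lemma bridge_irrefl : irreflexive bridge.
Proof.
by move=> i; apply/negbTE/negP => /bridge_component; rewrite eqxx.
Qed.

(** Distinct partners of [i] are 2h apart in position, whereas positions within one component differ
    by less than h. *)
Lemma bridge_inj i j m : bridge i j -> bridge i m ->
  component g j = component g m -> j = m.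
Proof.
move=> ij im cjm; apply: (@position_inj _ g).
have jm := position_component cjm; have mj := position_component (esym cjm).
have /andP[_ hj] := g_size j; have /andP[_ hm] := g_size m.
by move: ij im; rewrite /bridge /pos /h; lia.
Qed.

(** Step down by [h] if possible; otherwise [pos i + h < 2h <= n] leaves room above. *)
Lemma bridge_total i : exists j, bridge i j.
Proof.
have := position_ltn g i; have [hi|hi] := leqP h (pos i).
  move=> lt_in; have [|j ji] := @position_surj _ g (pos i - h)%N; first by rewrite /pos; lia.
  by exists j; rewrite /bridge /pos ji; apply/orP; right; apply/eqP/subnK.
have [|j ji] := @position_surj _ g (pos i + h)%N; first by rewrite /h in hi *; lia.
by exists j; rewrite /bridge /pos ji eqxx.
Qed.

Let bridged_link : rel 'I_n := fun i j => g i j || bridge i j.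

Lemma bridged_sym : symmetric bridged_link.
Proof. by move=> i j; rewrite /bridged_link link_sym bridge_sym. Qed.

Lemma bridged_irrefl : irreflexive bridged_link.
Proof. by move=> i; rewrite /bridged_link link_irrefl bridge_irrefl. Qed.

Definition bridged : network n := Network bridged_sym bridged_irrefl.

Lemma bridged_extension : (0 < n)%N -> extension g bridged.
Proof.
move=> n_gt0; split=> [i j /= gij|]; first by rewrite /bridged_link gij.
have [j ij] := bridge_total (Ordinal n_gt0).
exists (Ordinal n_gt0), j; rewrite /= /bridged_link ij orbT; split=> //.
by apply: contraNN (bridge_component ij) => /link_component ->.
Qed.

(** If [i] and [m] are not linked, [m] itself escapes. Across an old link, a bridge partner of [m]
    does, since [m] is that partner's only bridge into the component. Across a bridge, an old
    neighbour of [m] does, since [i] is bridged to [m] alone in that component. *)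
Lemma bridged_escape i m : m != i ->
  exists2 j, j \in neighborhood bridged m & j \notin neighborhood bridged i.
Proof.
move=> mi; case: (boolP (bridged_link i m)) => [|im]; last first.
  by exists m; rewrite !inE ?eqxx ?orbT // negb_or im.
case/orP => im.
  have [j mj] := bridge_total m; exists j.
    by rewrite !inE /= /bridged_link mj orbT.
  have cim := link_component im; have cmj := bridge_component mj.
  rewrite !inE /= /bridged_link 2!negb_or -andbA; apply/and3P; split.
  - by apply: contraNN cmj => /link_component <-; rewrite cim.
  - apply: contraNN mi; rewrite bridge_sym => ij.
    by rewrite (bridge_inj ij (j := i) (m := m)) // bridge_sym.
  - by apply: contraNneq cmj => ->; rewrite cim.
have [j mj] := galaxy_has_link g_galaxy (fun i => proj1 (andP (g_size i))) m.
exists j; first by rewrite !inE /= /bridged_link mj.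
have cmj := link_component mj; have cim := bridge_component im.
rewrite !inE /= /bridged_link 2!negb_or -andbA; apply/and3P; split.
- by apply: contraNN cim => /link_component ->; rewrite cmj.
- apply/negP => ij; have mj' := bridge_inj im ij cmj.
  by rewrite -mj' link_irrefl in mj.
- by apply: contraNneq cim => <-; rewrite cmj.
Qed.

End Bridging.

Theorem theorem2
  (R : realType) (n k : nat)
  (M : countType) (mx my : M) (hxy : mx != my)
  (hM : infinite_set [set: M]%classic)
  (prior : state -> R)
  (hX : 0 < prior stX) (hY : 0 < prior stY)
  (hprior : \sum_(w : state) prior w = 1)
  (hk_lb : ((n + 1) %/ 2 <= k)%N) (hk_ub : (k <= n)%N)
  (hprior_k : prior stX < k%:R / (n + k)%:R)
  (g : network n)
  (hgalaxy : galaxy g)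
  (hell : (2 <= #|components g|)%N)
  (hsize : forall C : {set 'I_n}, C \in components g ->
     (3 <= #|C| <= minn (k - 1) (n %/ 2))%N)
  (hunion : forall D : {set {set 'I_n}}, D \subset components g ->
     #|finset.cover D| <> k) :
  network_value M prior k g < empty_network_value n M prior k /\
  exists g' : network n, extension g g' /\
    exists p : experiment R n M,
      experiment_value prior k g' p = empty_network_value n M prior k.
Proof.
have prior_gt0 w : 0 < prior w by case: w.
have prior1 : prior stX + prior stY = 1 by rewrite -sum_state.
have [C CC] : exists C, C \in components g.
  by apply/card_gt0P; exact: leq_trans hell.
have n_gt0 : (0 < n)%N.
  have /andP[C3 Cmin] := hsize C CC.
  by have := leq_trans C3 (leq_trans Cmin (geq_minr _ _)); lia.
have k_gt0 : (0 < k)%N by lia.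
have k0 : 0 < k%:R :> R by rewrite ltr0n.
pose V := (1 + n%:R / k%:R) * prior stX.
have V_ub h : ubound (range (@experiment_value R n M prior k h)) V.
  by move=> _ [p _ <-]; exact: experiment_value_le.
have optimal (h : network n) : (forall i m, m != i ->
      exists2 j, j \in neighborhood h m & j \notin neighborhood h i) ->
    exists p : experiment R n M, experiment_value prior k h p = V.
  move=> esc; have [|p pV] := exists_optimal_experiment (k := k) mx hM prior_gt0 esc _ prior1 hprior_k.
    by rewrite k_gt0.
  by exists p; apply/eqP; rewrite eq_le pV andbT; apply: (V_ub h); exists p.
have [p0 p0V] : exists p : experiment R n M, experiment_value prior k (empty_network n) p = V.
  apply: (optimal (empty_network n)) => i m mi; exists m; first by rewrite !inE eqxx.
  by rewrite !inE negb_or mi.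
have VE : empty_network_value n M prior k = V.
  apply/eqP; rewrite eq_le; apply/andP; split.
    by apply: ge_sup; [exists V, p0 | exact: V_ub].
  by apply: ub_le_sup; [exists V; exact: V_ub | exists p0].
rewrite VE; split.
  have [c [sub_c c_const]] := galaxy_centre hgalaxy.
  have split_c := quota_splits_component c_const hunion.
  (* This bound is uniform in the experiment, so the inequality stays strict for the supremum. *)
  apply: (@le_lt_trans _ _ ((1 + (n * n.+1)%:R / (n.+1 * k + 1)%:R) * prior stX)).
    apply: ge_sup; first by exists (experiment_value prior k g p0), p0.
    by move=> _ [p _ <-]; exact: experiment_value_centred_le sub_c split_c.
  (* Cross-multiplied, the claim is n (n + 1) k < n ((n + 1) k + 1). *)
  rewrite ltr_pM2r // ltrD2l ltr_pdivrMr ?ltr0n ?addn1 //.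
  rewrite mulrAC ltr_pdivlMr // -!natrM ltr_nat; lia.
have size_bounds i : (1 < #|component g i| <= n %/ 2)%N.
  have /andP[C3 Cmin] := hsize _ (component_in g i).
  by rewrite (ltnW C3) (leq_trans Cmin (geq_minr _ _)).
exists (bridged size_bounds); split; first exact: bridged_extension.
exact: optimal (bridged_escape hgalaxy size_bounds).
Qed.
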